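(* Let $\mathcal{M}$ be a Type $\mathcal{A}$ symmetric affine surface with non-parallel torsion tensor ($\nabla T\neq0$). Then $\mathcal{M}$ is flat (i.e. $\rho=0$), and $\mathcal{M}$ is equivalent under the action of the gauge group $\operatorname{GL}(2,\mathbb{R})$ to one of the following 6 geometries, where $\alpha,\omega\in\mathbb{R}$, $\eta\in\mathbb{R}$ with $\eta\ge0$, $\beta\in\mathbb{R}-\{0,2\}$, $\gamma\in\mathbb{R}-\{0\}$, $\varepsilon=\pm1$, and where in every case $T=(dx^1\wedge dx^2)\otimes\partial_{x^2}$: \begin{enumerate} \item $\Gamma_{11}{}^1=\gamma$, $\Gamma_{11}{}^2=\gamma-1$, $\Gamma_{12}{}^1=0$, $\Gamma_{12}{}^2=1$, $\Gamma_{21}{}^1=0$, $\Gamma_{21}{}^2=-1$, $\Gamma_{22}{}^1=0$, $\Gamma_{22}{}^2=1$; $\quad\nabla T=\left(\begin{array}{cc}0&-\gamma\\0&0\end{array}\right)$. \item $\Gamma_{11}{}^1=0$, $\Gamma_{11}{}^2=\alpha$, $\Gamma_{12}{}^1=1$, $\Gamma_{12}{}^2=2$, $\Gamma_{21}{}^1=1$, $\Gamma_{21}{}^2=0$, $\Gamma_{22}{}^1=0$, $\Gamma_{22}{}^2=1$; $\quad\nabla T=\left(\begin{array}{cc}1&0\\0&-1\end{array}\right)$. \item $\Gamma_{11}{}^1=\gamma$, $\Gamma_{11}{}^2=0$, $\Gamma_{12}{}^1=0$, $\Gamma_{12}{}^2=\gamma$, $\Gamma_{21}{}^1=0$, $\Gamma_{21}{}^2=\gamma-2$,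 $\Gamma_{22}{}^1=0$, $\Gamma_{22}{}^2=0$; $\quad\nabla T=\left(\begin{array}{cc}0&-\gamma\\0&0\end{array}\right)$. \item $\Gamma_{11}{}^1=2$, $\Gamma_{11}{}^2=1$, $\Gamma_{12}{}^1=0$, $\Gamma_{12}{}^2=2$, $\Gamma_{21}{}^1=0$, $\Gamma_{21}{}^2=0$, $\Gamma_{22}{}^1=0$, $\Gamma_{22}{}^2=0$; $\quad\nabla T=\left(\begin{array}{cc}0&-2\\0&0\end{array}\right)$. \item $\Gamma_{11}{}^1=\beta$, $\Gamma_{11}{}^2=0$, $\Gamma_{12}{}^1=0$, $\Gamma_{12}{}^2=2$, $\Gamma_{21}{}^1=0$, $\Gamma_{21}{}^2=0$, $\Gamma_{22}{}^1=0$, $\Gamma_{22}{}^2=0$; $\quad\nabla T=\left(\begin{array}{cc}0&-\beta\\0&0\end{array}\right)$. \item $\Gamma_{11}{}^1=\omega$, $\Gamma_{11}{}^2=0$, $\Gamma_{12}{}^1=0$, $\Gamma_{12}{}^2=\omega$, $\Gamma_{21}{}^1=0$, $\Gamma_{21}{}^2=\omega-2$, $\Gamma_{22}{}^1=\varepsilon$, $\Gamma_{22}{}^2=\eta$; $\quad\nabla T=\left(\begin{array}{cc}0&-\omega\\\varepsilon&0\end{array}\right)$. \end{enumerate} Moreover, no two different surfaces in this list (different families, or the same family with different parameter values) are linearly equivalent.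
   Context: An affine surface is a pair $\mathcal{M}=(M,\nabla)$ where $M$ is a smooth 2-dimensional manifold and $\nabla$ is a connection on the tangent bundle of $M$; the torsion is permitted to be non-zero. The torsion tensor is $T(X,Y):=\frac12(\nabla_XY-\nabla_YX-[X,Y])$. The curvature operator is $R(X,Y):=\nabla_X\nabla_Y-\nabla_Y\nabla_X-\nabla_{[X,Y]}$ and the Ricci tensor is $\rho(X,Y):=\operatorname{Trace}(Z\mapsto R(Z,X)Y)$. $\mathcal{M}$ is symmetric if $\nabla R=0$, or equivalently (in dimension 2) if $\nabla\rho=0$. In local coordinates $\nabla_{\partial_{x^i}}\partial_{x^j}=\Gamma_{ij}{}^k\partial_{x^k}$ (in general $\Gamma_{ij}{}^k\ne\Gamma_{ji}{}^k$). In coordinates, $T=\frac12(dx^1\wedge dx^2)\otimes\{(\Gamma_{12}{}^1-\Gamma_{21}{}^1)\partial_{x^1}+(\Gamma_{12}{}^2-\Gamma_{21}{}^2)\partial_{x^2}\}$. The matrices displayed for $\nabla T$ have as $(i,k)$ entry (row $i$, column $k$) the coefficient of $(dx^1\wedge dx^2)\otimes\partial_{x^k}$ in $\nabla_{\partial_{x^i}}T$. A geometry is of Type $\mathcal{A}$ if it has coordinates $(x^1,x^2)$ in which all the Christoffel symbols $\Gamma_{ij}{}^k$ are real constants; a Type $\mathcal{A}$ geometry is thus specified by its 8 constants $\Gamma_{ij}{}^k\in\mathbb{R}$, and may be regarded as a connection on $\mathbb{R}^2$. The general linear group $\operatorname{GL}(2,\mathbb{R})$ acts on the set of Type $\mathcal{A}$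 geometries by linear change of the coordinates $(x^1,x^2)$; two Type $\mathcal{A}$ geometries are linearly equivalent (equivalent under the gauge group) if they lie in the same orbit of this action. *)

(* Defs.v *)
From HB Require Import structures.
From mathcomp Require Import all_boot all_order all_algebra.
From mathcomp Require Import all_classical all_reals all_analysis.

Set Implicit Arguments.
Unset Strict Implicit.
Unset Printing Implicit Defensive.

Import Order.TTheory GRing.Theory Num.Theory.
Import numFieldNormedType.Exports.
Local Open Scope ring_scope.

(* Points and tangent vectors of R^2 are row vectors; coordinate indices 1, 2
   are the elements 0, 1 of 'I_2. *)
Definition vfield (R : realType) := 'rV[R]_2 -> 'rV[R]_2.

(* [G i j k] is the constant Christoffel symbol Gamma_{ij}^k. *)
Definition typeA (R : realType) := 'I_2 -> 'I_2 -> 'I_2 -> R.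

Definition constvf (R : realType) (u : 'rV[R]_2) : vfield R := fun=> u.

Definition coordvf {R : realType} (i : 'I_2) : vfield R :=
  constvf (delta_mx 0 i).

(* The connection on R^2 with nabla_{d_i} d_j = sum_k G i j k d_k, extended to
   vector fields by the Leibniz rule. *)
Definition nabla (R : realType) (G : typeA R) (X Y : vfield R) : vfield R :=
  fun p => 'D_(X p) Y p
    + \row_k (\sum_i \sum_j X p 0 i * Y p 0 j * G i j k).

Definition lie_bracket (R : realType) (X Y : vfield R) : vfield R :=
  fun p => 'D_(X p) Y p - 'D_(Y p) X p.

Definition torsion (R : realType) (G : typeA R) (X Y : vfield R) : vfield R :=
  fun p => 2^-1 *: (nabla G X Y p - nabla G Y X p - lie_bracket X Y p).

Definition curvature (R : realType) (G : typeA R) (X Y Z : vfield R) :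
    vfield R :=
  fun p => nabla G X (nabla G Y Z) p - nabla G Y (nabla G X Z) p
    - nabla G (lie_bracket X Y) Z p.

Definition ricci (R : realType) (G : typeA R) (X Y : vfield R) :
    'rV[R]_2 -> R :=
  fun p => \tr (lin1_mx (fun z => curvature G (constvf z) X Y p)).

(* (nabla_V T)(X, Y) *)
Definition nabla_torsion (R : realType) (G : typeA R) (V X Y : vfield R) :
    vfield R :=
  fun p => nabla G V (torsion G X Y) p
    - torsion G (nabla G V X) Y p - torsion G X (nabla G V Y) p.

(* (nabla_V R)(X, Y) Z *)
Definition nabla_curvature (R : realType) (G : typeA R)
    (V X Y Z : vfield R) : vfield R :=
  fun p => nabla G V (curvature G X Y Z) p
    - curvature G (nabla G V X) Y Z p - curvature G X (nabla G V Y) Z p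
    - curvature G X Y (nabla G V Z) p.

(* A tensor field is evaluated on tangent vectors by extending these to
   vector fields; by tensoriality the constant extension may be used. *)
Definition symmetric_surface (R : realType) (G : typeA R) : Prop :=
  forall p v x y z : 'rV[R]_2,
    nabla_curvature G (constvf v) (constvf x) (constvf y) (constvf z) p = 0.

Definition parallel_torsion (R : realType) (G : typeA R) : Prop :=
  forall p v x y : 'rV[R]_2,
    nabla_torsion G (constvf v) (constvf x) (constvf y) p = 0.

Definition flat (R : realType) (G : typeA R) : Prop :=
  forall p x y : 'rV[R]_2, ricci G (constvf x) (constvf y) p = 0.

(* dx^1 /\ dx^2, normalized to take the value 1 on (d_1, d_2). *)
Definition dx12 (R : realType) (x y : 'rV[R]_2) : R :=
  x 0 0 * y 0 1 - x 0 1 * y 0 0.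

(* T = (dx^1 /\ dx^2) (x) w *)
Definition torsion_is (R : realType) (G : typeA R) (w : 'rV[R]_2) : Prop :=
  forall p x y : 'rV[R]_2,
    torsion G (constvf x) (constvf y) p = dx12 x y *: w.

(* nabla_{d_i} T = (dx^1 /\ dx^2) (x) sum_k N i k d_k for all i *)
Definition nabla_torsion_is (R : realType) (G : typeA R) (N : 'M[R]_2) :
    Prop :=
  forall (i : 'I_2) (p x y : 'rV[R]_2),
    nabla_torsion G (coordvf i) (constvf x) (constvf y) p
    = dx12 x y *: row i N.

(* Christoffel symbols in the linear coordinates y given by x = y *m P, for
   which d/dy^i = sum_a P i a d/dx^a. *)
Definition gauge (R : realType) (P : 'M[R]_2) (G : typeA R) : typeA R :=
  fun i j k => \sum_a \sum_b \sum_c P i a * P j b * G a b c * invmx P c k.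

Definition linearly_equivalent (R : realType) (G H : typeA R) : Prop :=
  exists2 P : 'M[R]_2, P \in unitmx & forall i j k, H i j k = gauge P G i j k.

(* The arguments are listed in the order
   Gamma_{11}^1, Gamma_{11}^2, Gamma_{12}^1, Gamma_{12}^2,
   Gamma_{21}^1, Gamma_{21}^2, Gamma_{22}^1, Gamma_{22}^2. *)
Definition mk_typeA (R : realType)
    (g111 g112 g121 g122 g211 g212 g221 g222 : R) : typeA R :=
  fun i j k =>
    nth 0 [:: g111; g112; g121; g122; g211; g212; g221; g222]
      (4 * i + 2 * j + k)%N.

(* The rows are (a, b) and (c, d). *)
Definition mk_mx (R : realType) (a b c d : R) : 'M[R]_2 :=
  \matrix_(i < 2, k < 2) nth 0 [:: a; b; c; d] (2 * i + k)%N.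

Inductive model (R : realType) : Type :=
| Model1 (gamma : R)
| Model2 (alpha : R)
| Model3 (gamma : R)
| Model4
| Model5 (beta : R)
| Model6 (omega epsilon eta : R).

Definition admissible (R : realType) (m : model R) : Prop :=
  match m with
  | Model1 gamma => gamma <> 0
  | Model2 _ => True
  | Model3 gamma => gamma <> 0
  | Model4 => True
  | Model5 beta => beta <> 0 /\ beta <> 2
  | Model6 _ epsilon eta => (epsilon = 1 \/ epsilon = -1) /\ 0 <= eta
  end.

Definition model_surface (R : realType) (m : model R) : typeA R :=
  match m with
  | Model1 gamma => mk_typeA gamma (gamma - 1) 0 1 0 (-1) 0 1
  | Model2 alpha => mk_typeA 0 alpha 1 2 1 0 0 1
  | Model3 gamma => mk_typeA gamma 0 0 gamma 0 (gamma - 2) 0 0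
  | Model4 => mk_typeA 2 1 0 2 0 0 0 0
  | Model5 beta => mk_typeA beta 0 0 2 0 0 0 0
  | Model6 omega epsilon eta =>
      mk_typeA omega 0 0 omega 0 (omega - 2) epsilon eta
  end.

Definition model_nabla_torsion (R : realType) (m : model R) : 'M[R]_2 :=
  match m with
  | Model1 gamma => mk_mx 0 (- gamma) 0 0
  | Model2 _ => mk_mx 1 0 0 (-1)
  | Model3 gamma => mk_mx 0 (- gamma) 0 0
  | Model4 => mk_mx 0 (- 2) 0 0
  | Model5 beta => mk_mx 0 (- beta) 0 0
  | Model6 omega epsilon _ => mk_mx 0 (- omega) epsilon 0
  end.

(* Main.v *)
Require Import Defs.
From mathcomp Require Import all_boot all_order all_algebra.
From mathcomp Require Import all_classical all_reals all_analysis.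
From mathcomp Require Import ring lra.

(* On constant vector fields, nabla is the bilinear product of an algebra
   structure on R^2, and linear equivalence is isomorphism of such algebras.
   Let A_v be the matrix of nabla_v and K = [A_2, A_1] the curvature. Symmetry
   says [K, A_v] = tr(A_v) K, which forces tr(K^2) = 0; if the nilpotent K is
   nonzero, the torsion vector lies in its image and is parallel. Hence K = 0.
   Normalizing the torsion vector to d_2 leaves six parameters subject to
   [A_1, A_2] = 0 and the two-parameter group d_1 |-> d_1 + p d_2,
   d_2 |-> q d_2, whose orbits are then listed. *)

Import Order.TTheory GRing.Theory Num.Theory.
Local Open Scope ring_scope.

Set Implicit Arguments.
Unset Strict Implicit.
Unset Printing Implicit Defensive.

Lemma forall_ord2 (P : 'I_2 -> Prop) : P 0 -> P 1 -> forall i, P i.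
Proof.
move=> P0 P1 [[|[|//]] lti]; first by rewrite (_ : Ordinal lti = 0) //; exact: val_inj.
by rewrite (_ : Ordinal lti = 1) //; exact: val_inj.
Qed.

Lemma sum_ord2 (V : nmodType) (F : 'I_2 -> V) : \sum_i F i = F 0 + F 1.
Proof.
rewrite !big_ord_recl big_ord0 addr0; congr (_ + F _); exact: val_inj.
Qed.

Lemma row2_eq (T : Type) (u v : 'rV[T]_2) :
  u 0 0 = v 0 0 -> u 0 1 = v 0 1 -> u = v.
Proof. by move=> e0 e1; apply/rowP; apply: forall_ord2. Qed.

(** * Constant vector fields and the algebra they form *)

Section Algebra.
Variable R : realType.
Implicit Types (G H : typeA R) (P : 'M[R]_2) (u v w x y z : 'rV[R]_2).

Definition cprod G x y : 'rV[R]_2 :=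
  \row_k (\sum_i \sum_j x 0 i * y 0 j * G i j k).

Lemma cprodE G x y k :
  cprod G x y 0 k = x 0 0 * y 0 0 * G 0 0 k + x 0 0 * y 0 1 * G 0 1 k
    + (x 0 1 * y 0 0 * G 1 0 k + x 0 1 * y 0 1 * G 1 1 k).
Proof. by rewrite mxE !sum_ord2. Qed.

(** Here and below, the prefix [c] marks the value of a tensor on constant vector fields:
    derivatives and Lie brackets vanish there, so only [cprod] terms remain. *)
Definition ctors G x y := 2^-1 *: (cprod G x y - cprod G y x).

Definition ccurv G x y z := cprod G x (cprod G y z) - cprod G y (cprod G x z).

Definition cntors G v x y :=
  cprod G v (ctors G x y) - ctors G (cprod G v x) y - ctors G x (cprod G v y).

Definition cncurv G v x y z :=
  cprod G v (ccurv G x y z) - ccurv G (cprod G v x) y z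
  - ccurv G x (cprod G v y) z - ccurv G x y (cprod G v z).

Lemma nabla_const G x y :
  nabla G (constvf x) (constvf y) = constvf (cprod G x y).
Proof. by apply/funext => p; rewrite /nabla derive_cst add0r. Qed.

Lemma lie_bracket_const x y : lie_bracket (constvf x) (constvf y) = constvf 0.
Proof. by apply/funext => p; rewrite /lie_bracket !derive_cst subrr. Qed.

Lemma torsion_const G x y :
  torsion G (constvf x) (constvf y) = constvf (ctors G x y).
Proof.
by apply/funext => p; rewrite /torsion !nabla_const lie_bracket_const /constvf subr0.
Qed.

Lemma cprod0l G x : cprod G 0 x = 0.
Proof. by apply: row2_eq; rewrite cprodE !mxE; ring. Qed.

Lemma curvature_const G x y z :
  curvature G (constvf x) (constvf y) (constvf z) = constvf (ccurv G x y z).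
Proof.
apply/funext => p; rewrite /curvature lie_bracket_const !nabla_const.
by rewrite /constvf cprod0l subr0.
Qed.

Lemma nabla_torsion_const G v x y :
  nabla_torsion G (constvf v) (constvf x) (constvf y) = constvf (cntors G v x y).
Proof.
by apply/funext => p; rewrite /nabla_torsion torsion_const !nabla_const !torsion_const.
Qed.

Lemma nabla_curvature_const G v x y z :
  nabla_curvature G (constvf v) (constvf x) (constvf y) (constvf z) =
  constvf (cncurv G v x y z).
Proof.
apply/funext => p.
by rewrite /nabla_curvature curvature_const !nabla_const !curvature_const.
Qed.

Lemma symmetric_surfaceP G :
  symmetric_surface G <-> forall v x y z, cncurv G v x y z = 0.
Proof.
by split=> h; [move=> v x y z; have := h 0 v x y z | move=> p v x y z];
  rewrite nabla_curvature_const //; exact: h.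
Qed.

Lemma parallel_torsionP G :
  parallel_torsion G <-> forall v x y, cntors G v x y = 0.
Proof.
by split=> h; [move=> v x y; have := h 0 v x y | move=> p v x y];
  rewrite nabla_torsion_const //; exact: h.
Qed.

Lemma flat_ccurv G : (forall x y z, ccurv G x y z = 0) -> flat G.
Proof.
move=> h p x y; rewrite /ricci (_ : lin1_mx _ = 0) ?mxtrace0 //.
by apply/matrixP => i j; rewrite mxE curvature_const /constvf h !mxE.
Qed.

(* A linear change of coordinates is an isomorphism between the algebras
   [(R^2, cprod H)] and [(R^2, cprod G)]. *)
Definition cmorph G H P :=
  forall x y, cprod H x y *m P = cprod G (x *m P) (y *m P).

Lemma cmorphP G H P : cmorph G H P <->
  forall i j k, H i j 0 * P 0 k + H i j 1 * P 1 k
    = cprod G (row i P) (row j P) 0 k.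
Proof.
split=> [hP i j k|E x y].
  rewrite !rowE -hP mxE sum_ord2 !cprodE !mxE.
  by move: i j; do 2!apply: forall_ord2; rewrite /=; ring.
apply/rowP => k; rewrite mxE sum_ord2 !cprodE.
have := (E 0 0 k, E 0 1 k, E 1 0 k, E 1 1 k).
rewrite !cprodE !mxE !sum_ord2 => -[[[E00 E01] E10] E11].
transitivity (x 0 0 * y 0 0 * (H 0 0 0 * P 0 k + H 0 0 1 * P 1 k)
  + x 0 0 * y 0 1 * (H 0 1 0 * P 0 k + H 0 1 1 * P 1 k)
  + x 0 1 * y 0 0 * (H 1 0 0 * P 0 k + H 1 0 1 * P 1 k)
  + x 0 1 * y 0 1 * (H 1 1 0 * P 0 k + H 1 1 1 * P 1 k)); first by ring.
by rewrite E00 E01 E10 E11; ring.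
Qed.

(** Row i of [P] is the image of the i-th basis vector, so [gauge] multiplies two images in [G] and
    pulls the product back by the inverse of [P]. *)
Lemma gaugeP G H P : P \in unitmx ->
  cmorph G H P <-> forall i j k, H i j k = gauge P G i j k.
Proof.
move=> uP.
have gaugeE i j : \row_k gauge P G i j k = cprod G (row i P) (row j P) *m invmx P.
  by apply/rowP => k; rewrite /gauge !mxE !sum_ord2 !cprodE !mxE; ring.
rewrite cmorphP; split=> hP i j k.
  have -> : H i j k = (\row_k H i j k) 0 k by rewrite mxE.
  transitivity ((\row_k gauge P G i j k) 0 k); last by rewrite mxE.
  rewrite gaugeE.
  rewrite (_ : cprod _ _ _ = (\row_k H i j k) *m P) ?mulmxK //.
  by apply/rowP => l; rewrite -hP mxE sum_ord2 !mxE.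
have -> : H i j 0 * P 0 k + H i j 1 * P 1 k = ((\row_k gauge P G i j k) *m P) 0 k.
  by rewrite mxE sum_ord2 !mxE !hP.
by rewrite gaugeE mulmxKV.
Qed.

Lemma linearly_equivalentP G H :
  linearly_equivalent G H <-> exists2 P, P \in unitmx & cmorph G H P.
Proof. by split=> -[P uP hP]; exists P => //; apply/(gaugeP _ _ uP). Qed.

Lemma linearly_equivalent_trans H G K :
  linearly_equivalent G H -> linearly_equivalent H K -> linearly_equivalent G K.
Proof.
move=> /linearly_equivalentP[P uP GH] /linearly_equivalentP[Q uQ HK].
apply/linearly_equivalentP; exists (Q *m P); first by rewrite unitmx_mul uQ.
by move=> x y; rewrite !mulmxA HK GH.
Qed.

(** * Transport of the tensors along an algebra morphism *)

Section Transport.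
Variables (G H : typeA R) (P : 'M[R]_2).
Hypothesis GH : cmorph G H P.

Lemma cmorph_ctors x y : ctors H x y *m P = ctors G (x *m P) (y *m P).
Proof. by rewrite /ctors -scalemxAl mulmxBl !GH. Qed.

Lemma cmorph_ccurv x y z :
  ccurv H x y z *m P = ccurv G (x *m P) (y *m P) (z *m P).
Proof. by rewrite /ccurv mulmxBl !GH. Qed.

Lemma cmorph_cntors v x y :
  cntors H v x y *m P = cntors G (v *m P) (x *m P) (y *m P).
Proof. by rewrite /cntors 2!mulmxBl GH !cmorph_ctors !GH. Qed.

Lemma cmorph_cncurv v x y z :
  cncurv H v x y z *m P = cncurv G (v *m P) (x *m P) (y *m P) (z *m P).
Proof. by rewrite /cncurv 3!mulmxBl GH !cmorph_ccurv !GH. Qed.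

End Transport.

(** * Normal form of the torsion and the remaining gauge group *)

Let e1 : 'rV[R]_2 := delta_mx 0 0.
Let e2 : 'rV[R]_2 := delta_mx 0 1.

Lemma ctors_dx12 G x y : ctors G x y = dx12 x y *: ctors G e1 e2.
Proof.
by apply: row2_eq; rewrite !(mxE, sum_ord2) /dx12 /=; ring.
Qed.

Lemma det2 P : \det P = P 0 0 * P 1 1 - P 0 1 * P 1 0.
Proof.
have l0 : lift (0 : 'I_2) (0 : 'I_1) = 1 by exact: val_inj.
have l1 : lift (1 : 'I_2) (0 : 'I_1) = 0 by exact: val_inj.
rewrite (expand_det_row _ 0) sum_ord2 /cofactor !det_mx11 !mxE l0 l1.
by rewrite expr0 expr1; ring.
Qed.

Lemma dx12_mul P x y : dx12 (x *m P) (y *m P) = \det P * dx12 x y.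
Proof. by rewrite det2 /dx12 !mxE !sum_ord2; ring. Qed.

(** An alternating form on the plane is determined by its value on the basis, and [P] multiplies
    [dx12] by its determinant. *)
Lemma torsion_cmorph G H P : cmorph G H P ->
  ctors H e1 e2 *m P = \det P *: ctors G e1 e2.
Proof.
move=> /cmorph_ctors ->; rewrite ctors_dx12 dx12_mul; congr (_ *: _).
by rewrite /dx12 !mxE /=; ring.
Qed.

(* The connections with [T = (dx^1 /\ dx^2) (x) d_2]. *)
Definition tnf (a b c d e f : R) : typeA R := mk_typeA a b c d c (d - 2) e f.

Lemma ctors_tnf a b c d e f : ctors (tnf a b c d e f) e1 e2 = e2.
Proof.
by apply: row2_eq; rewrite !(mxE, sum_ord2) /tnf /mk_typeA /=; field.
Qed.

Lemma tnfP G : ctors G e1 e2 = e2 ->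
  exists a b c d e f, forall i j k, G i j k = tnf a b c d e f i j k.
Proof.
move=> Ge.
exists (G 0 0 0), (G 0 0 1), (G 0 1 0), (G 0 1 1), (G 1 1 0), (G 1 1 1).
have := congr1 (fun u : 'rV_2 => (u 0 0, u 0 1)) Ge.
rewrite !(mxE, sum_ord2) /= => -[E0 E1].
do 3!apply: forall_ord2; rewrite /tnf /mk_typeA //=; lra.
Qed.

(** Determinant 1 removes the factor in [torsion_cmorph], so taking [w] to be the torsion vector
    makes it exactly [e2] in the new coordinates. *)
Lemma unimodular_row w : w != 0 -> exists2 P, \det P = 1 & row 1 P = w.
Proof.
move=> w_neq0.
have [u uw] : exists u, dx12 u w = 1.
  have [w1|w1] := eqVneq (w 0 1) 0; last first.
    by exists ((w 0 1)^-1 *: e1); rewrite /dx12 !mxE /=; field.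
  have [w0|w0] := eqVneq (w 0 0) 0.
    by case/eqP: w_neq0; apply: row2_eq; rewrite mxE.
  by exists (- (w 0 0)^-1 *: e2); rewrite /dx12 !mxE /=; field.
exists (\matrix_(i, j) if i == 0 then u 0 j else w 0 j).
  by rewrite det2 !mxE -uw.
by apply/rowP => j; rewrite !mxE.
Qed.

Lemma torsion_normal_form G : ctors G e1 e2 != 0 ->
  exists a b c d e f, linearly_equivalent G (tnf a b c d e f).
Proof.
move=> /unimodular_row[P detP rowE1].
have uP : P \in unitmx by rewrite unitmxE detP unitr1.
have GP : cmorph G (gauge P G) P by apply/(gaugeP _ _ uP).
have [a [b [c [d [e [f N]]]]]] : exists a b c d e f, forall i j k,
    gauge P G i j k = tnf a b c d e f i j k.
  apply: tnfP; apply: (can_inj (mulmxK uP)).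
  by rewrite (torsion_cmorph GP) detP scale1r -rowE1 rowE.
by exists a, b, c, d, e, f, P => // i j k; rewrite N.
Qed.

(** Both torsion vectors are [e2], so [torsion_cmorph] makes the second row of [P] equal to (0, det
    P). Then det P = [P 0 0 * P 1 1] forces [P 0 0 = 1], and [P] has rows (1, p) and (0, q). *)
Lemma tnf_equivalent (a b c d e f a' b' c' d' e' f' : R) :
  linearly_equivalent (tnf a b c d e f) (tnf a' b' c' d' e' f') <->
  exists p q : R, [/\ q != 0,
    e' = q ^+ 2 * e /\ f' = q * (f - p * e),
    c' = q * (c + p * e) /\ d' = d + p * (f - c - p * e),
    a' = a + 2 * p * c + p ^+ 2 * e
    & q * b' = b + p * (2 * d - 2 + p * f - a')].
Proof.
rewrite linearly_equivalentP; split=> [[P uP GH]|[p [q [q0 [Ee Ef] [Ec Ed] Ea Eb]]]].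
  have := torsion_cmorph GH; rewrite !ctors_tnf => /(congr1 (fun u : 'rV_2 => (u 0 0, u 0 1))).
  rewrite -rowE !mxE /= mulr0 mulr1 => -[P10 P11].
  have P11_neq0 : P 1 1 != 0 by rewrite P11 -unitfE -unitmxE.
  have P00 : P 0 0 = 1.
    by apply: (mulIf P11_neq0); rewrite mul1r [RHS]P11 det2 P10; ring.
  exists (P 0 1), (P 1 1).
  move/cmorphP: GH => E.
  have := (E 0 0 0, E 0 0 1, E 0 1 0, E 0 1 1, E 1 1 0, E 1 1 1).
  rewrite !cprodE !mxE /tnf /mk_typeA /= P10 P00.
  move: (P 0 1) (P 1 1) P11_neq0 => p q q_neq0.
  move=> [[[[[E1 E2] E3] E4] E5] E6].
  have Ea : a' = a + 2 * p * c + p ^+ 2 * e by lra.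
  have Ec : c' = q * (c + p * e) by lra.
  have Ee : e' = q ^+ 2 * e by lra.
  split=> //; last by lra.
    split=> //; apply: (mulIf q_neq0).
    by rewrite Ee in E6; lra.
  split=> //; apply: (mulIf q_neq0).
  by rewrite Ec in E4; lra.
exists (mk_mx 1 p 0 q).
  by rewrite unitmxE det2 !mxE /= mul1r mulr0 subr0 unitfE.
rewrite {}Ea {}Ec {}Ed {}Ee {}Ef in Eb *.
apply/cmorphP => i j k; rewrite cprodE !mxE.
by move: i j k; do 3!apply: forall_ord2; rewrite /tnf /mk_typeA /=; ring: Eb.
Qed.

(** * Tensors of the normal form and the symmetry condition *)

Lemma ctors_tnfE a b c d e f x y : ctors (tnf a b c d e f) x y = dx12 x y *: e2.
Proof. by rewrite ctors_dx12 ctors_tnf. Qed.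

Lemma cprod_tnf1 a b c d e f x :
  cprod (tnf a b c d e f) e1 x = x *m mk_mx a b c d.
Proof. by apply: row2_eq; rewrite !(mxE, sum_ord2) /tnf /mk_typeA /=; ring. Qed.

Lemma cprod_tnf2 a b c d e f x :
  cprod (tnf a b c d e f) e2 x = x *m mk_mx c (d - 2) e f.
Proof. by apply: row2_eq; rewrite !(mxE, sum_ord2) /tnf /mk_typeA /=; ring. Qed.

(** The derivative of T along v sends (e1, e2) to e2 A_v - tr(A_v) e2; the rows of the matrix are
    these vectors for v = e1 and v = e2. *)
Lemma cntors_tnf a b c d e f v x y : cntors (tnf a b c d e f) v x y =
  dx12 x y *: (v *m mk_mx c (- a) e (- c)).
Proof.
rewrite /cntors !ctors_tnfE.
by apply: row2_eq; rewrite /dx12 !(mxE, sum_ord2) /tnf /mk_typeA /=; ring.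
Qed.

Lemma ccurv_tnf a b c d e f x y z : ccurv (tnf a b c d e f) x y z =
  dx12 x y *: (z *m mk_mx (c * (d - 2) - b * e)
    (b * c + (d - a) * (d - 2) - b * f) (a * e + c * f - c ^+ 2 - d * e)
    (b * e - c * (d - 2))).
Proof.
by apply: row2_eq; rewrite /dx12 !(mxE, sum_ord2) /tnf /mk_typeA /=; ring.
Qed.

(** K has rows ([k1], [k2]) and ([k3], -[k1]); the six equations are entries of [K, A_v] = tr(A_v) K
    for v = e1, e2. By [cntors_tnf], the second alternative is parallel torsion. *)
Lemma curvature_alternative (a b c d e f k1 k2 k3 : R) :
  k1 = c * (d - 2) - b * e ->
  k2 = b * c + (d - a) * (d - 2) - b * f ->
  k3 = a * e + c * f - c ^+ 2 - d * e ->
  k2 * c - k3 * b = (a + d) * k1 ->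
  2 * b * k1 + (d - a) * k2 = (a + d) * k2 ->
  (a - d) * k3 - 2 * c * k1 = (a + d) * k3 ->
  k2 * e - k3 * (d - 2) = (c + f) * k1 ->
  2 * (d - 2) * k1 + (f - c) * k2 = (c + f) * k2 ->
  (c - f) * k3 - 2 * e * k1 = (c + f) * k3 ->
  [/\ k1 = 0, k2 = 0 & k3 = 0] \/ [/\ a = 0, c = 0 & e = 0].
Proof.
move=> K1 K2 K3 E11 E12 E13 E21 E22 E23.
(* This is tr(K A_1), which vanishes because K is the commutator [A_2, A_1]. *)
have KA : k1 * a + k2 * c + k3 * b - k1 * d = 0 by rewrite K1 K2 K3; ring.
have det0 : k1 ^+ 2 + k2 * k3 = 0.
  apply: (mulfI (_ : 2 != 0)) => //; rewrite mulr0.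
  (* 2 det0 = tr(K^2) = tr(K [A_2, A_1]) = tr([K, A_2] A_1) = tr(A_2) tr(K A_1) *)
  transitivity (2 * k1 * (c * (d - 2) - b * e)
    + k3 * (b * c + (d - a) * (d - 2) - b * f)
    + k2 * (a * e + c * f - c ^+ 2 - d * e)).
    by rewrite -K1 -K2 -K3; ring.
  transitivity ((k2 * e - k3 * (d - 2)) * (a - d)
    + (2 * (d - 2) * k1 + (f - c) * k2) * c
    + ((c - f) * k3 - 2 * e * k1) * b); first by ring.
  rewrite E21 E22 E23 -[RHS](mulr0 (c + f)) -KA; ring.
have [k30|k3_neq0] := eqVneq k3 0.
  have k10 : k1 = 0 by apply/eqP; rewrite -sqrf_eq0; apply/eqP; move: det0; rewrite k30; lra.
  have [k20|k2_neq0] := eqVneq k2 0; [by left|right].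
  move: E11 E12 E21; rewrite k30 k10 => E11 E12 E21.
  by split; apply: (mulIf k2_neq0); lra.
case/eqP: (k3_neq0).
(* [row2] and [row1] concern the first entries of e2 A_1 K and e1 A_2 K. The vectors e2 A_1 and e1
   A_2 differ by 2 e2, twice the torsion vector, so subtraction leaves 2 [k3] = 0. *)
have row2 : c * k1 + d * k3 = 0 by lra.
have row1 : c * k1 + (d - 2) * k3 = 0.
  apply: (mulIf k3_neq0); rewrite mul0r.
  transitivity (- k3 * (k2 * e - k3 * (d - 2) - (c + f) * k1)
    + e * (k1 ^+ 2 + k2 * k3)
    + k1 / 2 * ((c - f) * k3 - 2 * e * k1 - (c + f) * k3)); first by field.
  by rewrite E21 E23 det0; ring.
lra.
Qed.

Lemma tnf_symmetric a b c d e f :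
  (forall v x y z, cncurv (tnf a b c d e f) v x y z = 0) ->
  (forall x y z, ccurv (tnf a b c d e f) x y z = 0) \/
  (forall v x y, cntors (tnf a b c d e f) v x y = 0).
Proof.
move=> sym.
have [k1 [k2 [k3 [K1 K2 K3 curvE]]]] : exists k1 k2 k3,
    [/\ k1 = c * (d - 2) - b * e, k2 = b * c + (d - a) * (d - 2) - b * f,
        k3 = a * e + c * f - c ^+ 2 - d * e
      & forall x y z, ccurv (tnf a b c d e f) x y z =
          dx12 x y *: (z *m mk_mx k1 k2 k3 (- k1))].
  do 3!eexists; split; [reflexivity..|] => x y z.
  by rewrite ccurv_tnf opprB.
have E v z k : cncurv (tnf a b c d e f) v e1 e2 z 0 k = 0 by rewrite sym mxE.
have := (E e1 e1 0, E e1 e1 1, E e1 e2 0, E e2 e1 0, E e2 e1 1, E e2 e2 0).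
(* Differentiating the two arguments of the curvature yields the two diagonal entries of A_v, hence
   the term tr(A_v) K. *)
have dxl A : dx12 (e1 *m A) e2 = A 0 0.
  by rewrite /dx12 !(mxE, sum_ord2) /=; ring.
have dxr A : dx12 e1 (e2 *m A) = A 1 1.
  by rewrite /dx12 !(mxE, sum_ord2) /=; ring.
have dx1 : dx12 e1 e2 = 1 by rewrite /dx12 !mxE /=; ring.
rewrite /cncurv !curvE !cprod_tnf1 !cprod_tnf2 dx1 !dxl !dxr.
rewrite !scale1r !(mxE, sum_ord2) /=.
move=> [[[[[E11 E12] E13] E21] E22] E23] {E}.
have [[k10 k20 k30]|[a0 c0 e0]] := curvature_alternative K1 K2 K3
  ltac:(clear -E11; lra) ltac:(clear -E12; lra) ltac:(clear -E13; lra)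
  ltac:(clear -E21; lra) ltac:(clear -E22; lra) ltac:(clear -E23; lra).
- left=> x y z; rewrite curvE k10 k20 k30.
  by apply: row2_eq; rewrite !(mxE, sum_ord2) /=; ring.
right=> v x y; rewrite cntors_tnf a0 c0 e0.
by apply: row2_eq; rewrite !(mxE, sum_ord2) /=; ring.
Qed.

(** * The models and their tensors *)

Definition model_tnf (m : model R) : typeA R :=
  match m with
  | Model1 gamma => tnf gamma (gamma - 1) 0 1 0 1
  | Model2 alpha => tnf 0 alpha 1 2 0 1
  | Model3 gamma => tnf gamma 0 0 gamma 0 0
  | Model4 => tnf 2 1 0 2 0 0
  | Model5 beta => tnf beta 0 0 2 0 0
  | Model6 omega epsilon eta => tnf omega 0 0 omega epsilon eta
  end.

Implicit Types m n : model R.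

Lemma model_surfaceE m : model_surface m = model_tnf m.
Proof.
by case: m => * //=; rewrite /tnf; congr (mk_typeA _ _ _ _ _ _ _ _); ring.
Qed.

Lemma model_torsion m : torsion_is (model_surface m) e2.
Proof.
move=> p x y; rewrite model_surfaceE torsion_const /constvf.
by case: m => *; rewrite /= ctors_tnfE.
Qed.

Lemma model_nabla_torsionE m :
  nabla_torsion_is (model_surface m) (model_nabla_torsion m).
Proof.
move=> i p x y; rewrite model_surfaceE nabla_torsion_const /constvf rowE.
by case: m => *; rewrite /= cntors_tnf ?oppr0.
Qed.

(** * Orbits of the flat normal forms *)

(** The absolute value of [q] is fixed by normalizing [e]; its sign remains free and is used on
    [f]. *)
Lemma normalizing_scale (e f : R) : e != 0 ->
  exists q, [/\ q != 0, q ^+ 2 * e = 1 \/ q ^+ 2 * e = -1 & 0 <= q * f].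
Proof.
move=> e_neq0.
pose r := (Num.sqrt `|e|)^-1.
have r_gt0 : 0 < r by rewrite invr_gt0 sqrtr_gt0 normr_gt0.
have r2e : r ^+ 2 * e = 1 \/ r ^+ 2 * e = -1.
  rewrite exprVn sqr_sqrtr //; have [e_ge0|e_lt0] := leP 0 e.
    by left; rewrite ger0_norm // mulVf.
  by right; rewrite ltr0_norm // invrN mulNr mulVf.
have [f_ge0|f_lt0] := leP 0 f.
  by exists r; split=> //; [rewrite gt_eqF | rewrite mulr_ge0 // ltW].
exists (- r); split; first by rewrite oppr_eq0 gt_eqF.
  by rewrite sqrrN.
by rewrite mulNr -mulrN mulr_ge0 ?oppr_ge0 // ltW.
Qed.

(** The cases test [e], then [c], then [f]: each is only rescaled by the gauge group once the
    previous ones vanish. [K1], [K2], [K3] are the entries of [A_1, A_2] = 0. *)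
Lemma tnf_classification a b c d e f :
  (forall x y z, ccurv (tnf a b c d e f) x y z = 0) ->
  ~ (forall v x y, cntors (tnf a b c d e f) v x y = 0) ->
  exists2 m, admissible m & linearly_equivalent (tnf a b c d e f) (model_tnf m).
Proof.
move=> curv0 npar.
have npar' : ~ [/\ a = 0, c = 0 & e = 0].
  apply: contra_not npar => -[a0 c0 e0] v x y.
  rewrite cntors_tnf a0 c0 e0.
  by apply: row2_eq; rewrite !(mxE, sum_ord2) /=; ring.
have E z k : ccurv (tnf a b c d e f) e1 e2 z 0 k = 0 by rewrite curv0 mxE.
have := (E e1 0, E e1 1, E e2 0); rewrite !ccurv_tnf.
rewrite !(mxE, sum_ord2) /dx12 !mxE /= => -[[K1 K2] K3] {E curv0 npar}.
have {}K1 : c * (d - 2) = b * e by lra.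
have {}K2 : (d - a) * (d - 2) = b * (f - c) by lra.
have {}K3 : a * e = c * (c - f) + d * e by lra.
have [e0|e_neq0] := eqVneq e 0; last first.
  (* Clearing [c] requires p = -c/e, which turns f - p e into f + c. *)
  have [q [q_neq0 qe qf]] := normalizing_scale (f + c) e_neq0.
  exists (Model6 (a - c ^+ 2 / e) (q ^+ 2 * e) (q * (f + c))) => //=.
  have {}K1 : b = c * (d - 2) / e by apply: (mulIf e_neq0); rewrite -K1; field.
  have {}K3 : a = c * (c - f) / e + d by apply: (mulIf e_neq0); rewrite K3; field.
  apply/tnf_equivalent; exists (- c / e), q; split=> //; rewrite ?K1 ?K3;
      by [split; field | field].
subst e.
have [c0|c_neq0] := eqVneq c 0; last first.
  have d2 : d = 2 by apply: (mulfI c_neq0); lra.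
  have fc : f = c by apply: (mulfI c_neq0); lra.
  subst d f.
  (* Here p = -a/(2c) clears [a] and q = 1/c normalizes [c]; the parameter is the value that b' then
     takes. *)
  exists (Model2 (c * (b - a / (2 * c) * (2 - a / 2)))) => //=.
  apply/tnf_equivalent; exists (- a / (2 * c)), c^-1; split; rewrite ?invr_eq0 //=;
      by [split; field | field].
subst c.
have a_neq0 : a <> 0 by move=> a0; apply: npar'.
have [f0|f_neq0] := eqVneq f 0; last first.
  exists (Model1 a) => //=.
  (* [q] normalizes [f] to 1 and [p] moves [d] to 1. *)
  apply/tnf_equivalent; exists ((1 - d) / f), f^-1; split; rewrite ?invr_eq0 //.
  - by split; field.
  - by split; field.
  - by ring.
  have -> : b = (d - a) * (d - 2) / f by apply: (mulIf f_neq0); rewrite K2; field.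
  by field.
subst f.
have [da|d_neqa] := eqVneq d a.
  subst d; have [a2|a_neq2] := eqVneq a 2; last first.
    have a2_neq0 : a - 2 != 0 by rewrite subr_eq0.
    exists (Model3 a) => //=.
    apply/tnf_equivalent; exists (- b / (a - 2)), 1; split; rewrite ?oner_eq0 //=;
      by [split; field | field].
  (* At a = d = 2 the coefficient of [p] in b' vanishes, so [b] can only be rescaled: zero falls in
     the third family, and nonzero values give [Model4]. *)
  subst a; have [b0|b_neq0] := eqVneq b 0.
    subst b; exists (Model3 2) => //=.
    apply/tnf_equivalent; exists 0, 1; split; rewrite ?oner_eq0 //=;
      by [split; field | field].
  exists (Model4 R) => //=.
  apply/tnf_equivalent; exists 0, b; split=> //=;
      by [split; field | field].
have d2 : d = 2.
  have da_neq0 : d - a != 0 by rewrite subr_eq0.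
  by apply: (mulfI da_neq0); lra.
subst d; have a2_neq0 : a - 2 != 0 by rewrite subr_eq0 eq_sym.
exists (Model5 a); first by split=> // a2; move: a2_neq0; rewrite a2 subrr eqxx.
(* With d = 2 and f = 0, b' is b + p (2 - a), and this [p] clears it. *)
apply/tnf_equivalent; exists (b / (a - 2)), 1; split; rewrite ?oner_eq0 //=;
      by [split; field | field].
Qed.

(** * Inequivalence of the models *)

Lemma tnf_invariants (a b c d e f a' b' c' d' e' f' : R) :
  linearly_equivalent (tnf a b c d e f) (tnf a' b' c' d' e' f') ->
  [/\ (e' == 0) = (e == 0), e = 0 -> (c' == 0) = (c == 0),
      e = 0 -> c = 0 -> (f' == 0) = (f == 0) & e = 0 -> c = 0 -> a' = a].
Proof.
move=> /tnf_equivalent[p [q [q_neq0 [-> ->] [-> _] -> _]]].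
split=> [|e0|e0 _|-> ->]; rewrite ?e0; last by ring.
- by rewrite mulf_eq0 expf_eq0 /= (negPf q_neq0).
- by rewrite mulr0 addr0 mulf_eq0 (negPf q_neq0).
- by rewrite mulr0 subr0 mulf_eq0 (negPf q_neq0).
Qed.

Lemma model_tnf_inj m n : admissible m -> admissible n ->
  linearly_equivalent (model_tnf m) (model_tnf n) -> m = n.
Proof.
have eps0 (x y : R) : (x = 1 \/ x = -1) /\ 0 <= y -> (x == 0) = false.
  by case=> -[] -> _; rewrite ?oppr_eq0 oner_eq0.
case: m => [g|g|g||g|w s h]; case: n => [g'|g'|g'||g'|w' s' h'] adm adm' GH;
  rewrite /= in adm adm' GH; have [I1 I2 I3 I4] := tnf_invariants GH.
(* The zero pattern of [e], [c], [f] isolates families 6, 2 and 1. Families 3, 4 and 5 share e = c =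
   f = 0; there [a] and [d] are invariant, and at a = d = 2 the vanishing of [b] separates 3 from
   4. *)
all: try by move: I1; rewrite ?(eps0 _ _ adm) ?(eps0 _ _ adm') eqxx.
all: try by move: (I2 erefl); rewrite eqxx oner_eq0.
all: try by move: (I3 erefl erefl); rewrite eqxx oner_eq0.
all: move/tnf_equivalent: GH => [p [q [q_neq0 [Ee Ef] [Ec Ed] Ea Eb]]] {I1 I2 I3 I4 eps0}.
- by congr Model1; lra.
- have p0 : p = 0 by lra.
  have q1 : q = 1 by move: Ef; rewrite p0; lra.
  by congr Model2; move: Eb; rewrite p0 q1; lra.
- by congr Model3; lra.
- have g2 : g = 2 by lra.
  by exfalso; case/eqP: (q_neq0); move: Eb; rewrite g2; lra.
- by exfalso; case: adm' => _; apply; lra.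
- have g2 : g' = 2 by lra.
  by exfalso; move: Eb; rewrite g2; lra.
- by exfalso; case: adm' => _; apply; lra.
- by exfalso; case: adm => _; apply; lra.
- by exfalso; case: adm => _; apply; lra.
- by congr Model5; lra.
case: adm adm' => s_pm1 h_ge0 [s'_pm1 h'_ge0].
have s_neq0 : s != 0 by case: s_pm1 => ->; rewrite ?oppr_eq0 oner_eq0.
have p0 : p = 0.
  apply: (mulIf (mulf_neq0 q_neq0 s_neq0)); rewrite mul0r [RHS]Ec; ring.
have q2_gt0 : 0 < q ^+ 2 by rewrite exprn_even_gt0.
have {Ee}[q21 ss'] : q ^+ 2 = 1 /\ s' = s.
  by move: Ee; case: s_pm1 => ->; case: s'_pm1 => -> Ee; split=> //; lra.
have ww' : w' = w by rewrite Ea p0; ring.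
(* Only q^2 = 1 is known, so squares are compared; both parameters are nonnegative. *)
have hh' : h' = h.
  apply/eqP; rewrite -(eqrXn2 (n := 2)) // Ef p0 mul0r subr0 exprMn q21 mul1r //.
by rewrite ss' ww' hh'.
Qed.

(** * Return to an arbitrary surface *)

Lemma symmetric_classification G :
  symmetric_surface G -> ~ parallel_torsion G ->
  flat G /\
  exists2 m, admissible m & linearly_equivalent G (model_surface m).
Proof.
move=> /symmetric_surfaceP sym /parallel_torsionP npar.
have tors_neq0 : ctors G e1 e2 != 0.
  apply: contra_notN npar => /eqP T0 v x y.
  have {}T0 u w : ctors G u w = 0 by rewrite ctors_dx12 T0 scaler0.
  by rewrite /cntors !T0 !subr0; apply: row2_eq; rewrite cprodE !mxE; ring.
have [a [b [c [d [e [f GN]]]]]] := torsion_normal_form tors_neq0.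
have [P uP hP] := (linearly_equivalentP _ _).1 GN.
(* Every vector is an image under [P], so identities proved for the normal form carry back to
   [G]. *)
have backK u : u *m invmx P *m P = u by rewrite mulmxKV.
have nparN : ~ forall v x y, cntors (tnf a b c d e f) v x y = 0.
  apply: contra_not npar => par v x y.
  by rewrite -(backK v) -(backK x) -(backK y) -(cmorph_cntors hP) par mul0mx.
have curv0 : forall x y z, ccurv (tnf a b c d e f) x y z = 0.
  case: (tnf_symmetric (a := a) (b := b) (c := c) (d := d) (e := e) (f := f)) => // v x y z.
  by apply: (can_inj (mulmxK uP)); rewrite (cmorph_cncurv hP) sym mul0mx.
split.
  apply: flat_ccurv => x y z.
  by rewrite -(backK z) -(backK x) -(backK y) -(cmorph_ccurv hP) curv0 mul0mx.
have [m adm Nm] := tnf_classification curv0 nparN.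
exists m; rewrite // model_surfaceE.
exact: linearly_equivalent_trans GN Nm.
Qed.

End Algebra.

Theorem theorem4 (R : realType) :
  (forall G : typeA R,
     symmetric_surface G -> ~ parallel_torsion G ->
     flat G /\
     exists2 m : model R, admissible m
       & linearly_equivalent G (model_surface m))
  /\ (forall m : model R, admissible m ->
        torsion_is (model_surface m) (delta_mx 0 1)
        /\ nabla_torsion_is (model_surface m) (model_nabla_torsion m))
  /\ (forall m n : model R, admissible m -> admissible n ->
        m <> n ->
        ~ linearly_equivalent (model_surface m) (model_surface n)).
Proof.
split; first exact: symmetric_classification.
split=> [m _|m n adm_m adm_n mn].
  by split; [exact: model_torsion | exact: model_nabla_torsionE].
by rewrite !model_surfaceE => /(model_tnf_inj adm_m adm_n).
Qed.
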